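(* Let $n \ge 4$ be an integer and $T \in \mathbb{M}_n(\mathbb{C})$. The following are equivalent. (a) $T$ has property (CN). (b) $T$ has property (CR). (c) One of the following holds: (i) there exist $\lambda, \mu \in \mathbb{C}$ and a unitary $V \in \mathbb{M}_n(\mathbb{C})$ such that $T = \lambda I + \mu V$; (ii) there exist $\lambda, \mu \in \mathbb{C}$ and $L = L^* \in \mathbb{M}_n(\mathbb{C})$ such that $T = \lambda I + \mu L$.
   Context: $\mathbb{M}_n(\mathbb{C})$ is identified with the algebra of linear operators on the Hilbert space $\mathbb{C}^n$. A projection means an orthogonal projection ($P = P^2 = P^*$), and $P^\perp = I - P$. $\|\cdot\|$ is the operator norm. $T$ has the common norm property (CN) if $\|P T P^\perp\| = \|P^\perp T P\|$ for every projection $P$. $T$ has the common rank property (CR) if $\mathrm{rank}\, P T P^\perp = \mathrm{rank}\, P^\perp T P$ for every projection $P$. *)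

(* Defs.v *)
From mathcomp Require Import all_boot all_order all_algebra.
From mathcomp Require Import complex.
From mathcomp Require Import boolp classical_sets reals.

Set Implicit Arguments.
Unset Strict Implicit.
Unset Printing Implicit Defensive.

Import Order.TTheory GRing.Theory Num.Theory.

Local Open Scope ring_scope.
Local Open Scope complex_scope.
Local Open Scope sesquilinear_scope.
Local Open Scope classical_set_scope.

(* The complex numbers are R[i] with R : realType.  A matrix A acts on C^n,
   realized as column vectors, by x |-> A *m x; its adjoint is A ^t*. *)

Definition euclidean_norm (R : realType) (n : nat) (x : 'cV[R[i]]_n) : R :=
  Num.sqrt (\sum_(i < n) Normc.normc (x i 0) ^+ 2).

Definition operator_norm (R : realType) (n : nat) (A : 'M[R[i]]_n) : R :=
  sup [set euclidean_norm (A *m x)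
      | x in [set x : 'cV[R[i]]_n | euclidean_norm x <= 1]].

Definition is_projection (R : realType) (n : nat) (P : 'M[R[i]]_n) : Prop :=
  P *m P = P /\ P ^t* = P.

Definition perp (R : realType) (n : nat) (P : 'M[R[i]]_n) : 'M[R[i]]_n :=
  1%:M - P.

Definition common_norm (R : realType) (n : nat) (T : 'M[R[i]]_n) : Prop :=
  forall P : 'M[R[i]]_n, is_projection P ->
    operator_norm (P *m T *m perp P) = operator_norm (perp P *m T *m P).

Definition common_rank (R : realType) (n : nat) (T : 'M[R[i]]_n) : Prop :=
  forall P : 'M[R[i]]_n, is_projection P ->
    \rank (P *m T *m perp P) = \rank (perp P *m T *m P).

(* Main.v *)
(** Either property says that one off-diagonal corner of [T] vanishes when the
    other one does, so every invariant subspace of [T] is reducing and the Schur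
    form of [T] is diagonal.  For a rank-two projection [P] and a normal [T] the
    two corners have equal Frobenius norm, so equality of operator norms forces
    one corner to have rank at most one as soon as the other does.  Take [P] onto
    the span of [x] and [T x] with [x] the sum of the eigenvectors: one corner
    has rank at most one, hence so does the other, which is a linear relation
    between [1], [z], [conj z] and [z * conj z] valid on the whole spectrum.
    This puts the spectrum on a circle or a line.

    Conversely, for a unitary [V] the ranks agree because both corners have
    kernels governed by the intersection of a subspace with its image under [V].
    For the norms, a bound [k < 1] on one squared corner bounds [P V P] from below
    by [1 - k] on the range of [P]; in finite dimension the adjoint has the same
    lower bound, which bounds the other corner by [k]. *)

Require Import Defs.
From mathcomp Require Import all_boot all_order all_algebra.
From mathcomp Require Import complex.
From mathcomp Require Import boolp classical_sets reals.
From mathcomp Require Import ring.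

Set Implicit Arguments.
Unset Strict Implicit.
Unset Printing Implicit Defensive.

Import Order.TTheory GRing.Theory Num.Theory.

Local Open Scope ring_scope.
Local Open Scope sesquilinear_scope.

(** * Adjoints, the Frobenius norm and norm bounds *)

Section Adjoint.
Variable C : numClosedFieldType.

Lemma adjointM m n p (A : 'M[C]_(m, n)) (B : 'M[C]_(n, p)) :
  (A *m B)^t* = B^t* *m A^t*.
Proof. by rewrite trmx_mul map_mxM. Qed.

Lemma adjointD m n (A B : 'M[C]_(m, n)) : (A + B)^t* = A^t* + B^t*.
Proof. by rewrite linearD /= map_mxD. Qed.

Lemma adjointB m n (A B : 'M[C]_(m, n)) : (A - B)^t* = A^t* - B^t*.
Proof. by rewrite linearB /= map_mxB. Qed.

Lemma adjointZ m n (a : C) (A : 'M[C]_(m, n)) : (a *: A)^t* = a^* *: A^t*.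
Proof. by rewrite linearZ /= map_mxZ. Qed.

Lemma adjoint_diag n (d : 'rV[C]_n) : (diag_mx d)^t* = diag_mx (map_mx Num.conj d).
Proof. by rewrite tr_diag_mx map_diag_mx. Qed.

Lemma adjoint_scalar n (a : C) : (a%:M : 'M[C]_n)^t* = a^*%:M.
Proof. by rewrite tr_scalar_mx map_scalar_mx. Qed.

Lemma adjoint1 n : (1%:M : 'M[C]_n)^t* = 1%:M.
Proof. by rewrite adjoint_scalar rmorph1. Qed.

Lemma mxrank_adjoint m n (A : 'M[C]_(m, n)) : \rank (A^t*) = \rank A.
Proof. by rewrite mxrank_map mxrank_tr. Qed.

Lemma unitarymx_tr n (V : 'M[C]_n) : V \is unitarymx -> V^t* *m V = 1%:M.
Proof. by move=> /unitarymxP /mulmx1C. Qed.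

(** The squared Frobenius norm, hence the squared Euclidean norm on columns. *)
Definition sqnorm m n (A : 'M[C]_(m, n)) : C := \tr (A *m A^t*).

Lemma sqnormE m n (A : 'M[C]_(m, n)) : sqnorm A = \sum_i \sum_j `|A i j| ^+ 2.
Proof.
apply: eq_bigr => i _; rewrite mxE; apply: eq_bigr => j _.
by rewrite !mxE normCK.
Qed.

Lemma sqnorm_ge0 m n (A : 'M[C]_(m, n)) : 0 <= sqnorm A.
Proof. by rewrite sqnormE; do 2![apply: sumr_ge0 => ? _]; rewrite exprn_ge0. Qed.

Lemma sqnorm0 m n : sqnorm (0 : 'M[C]_(m, n)) = 0.
Proof. by rewrite /sqnorm mul0mx mxtrace0. Qed.

Lemma sqnorm_eq0 m n (A : 'M[C]_(m, n)) : sqnorm A = 0 -> A = 0.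
Proof.
rewrite sqnormE => /eqP; rewrite psumr_eq0 => [/allP A0|i _]; last first.
  by apply: sumr_ge0 => ? _; rewrite exprn_ge0.
apply/matrixP => i j; rewrite mxE.
have := A0 i (mem_index_enum _); rewrite psumr_eq0 => [/allP|? _]; last first.
  by rewrite exprn_ge0.
by move=> /(_ j (mem_index_enum _)); rewrite expf_eq0 normr_eq0 => /andP[_ /eqP].
Qed.

Lemma sqnorm_adjoint m n (A : 'M[C]_(m, n)) : sqnorm (A^t*) = sqnorm A.
Proof. by rewrite /sqnorm trmxCK mxtrace_mulC. Qed.

Lemma sqnormZ m n (a : C) (A : 'M[C]_(m, n)) :
  sqnorm (a *: A) = `|a| ^+ 2 * sqnorm A.
Proof.
by rewrite /sqnorm adjointZ -scalemxAl -scalemxAr scalerA mxtraceZ normCK.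
Qed.

Lemma sqnorm_unitary m n (V : 'M[C]_m) (A : 'M[C]_(m, n)) :
  V \is unitarymx -> sqnorm (V *m A) = sqnorm A.
Proof.
move=> Vu; rewrite /sqnorm adjointM mulmxA mxtrace_mulC !mulmxA.
by rewrite unitarymx_tr // mul1mx.
Qed.

Lemma sqnorm_pythagoras m n (P : 'M[C]_m) (A : 'M[C]_(m, n)) :
  P *m P = P -> P^t* = P ->
  sqnorm A = sqnorm (P *m A) + sqnorm ((1%:M - P) *m A).
Proof.
move=> PP Pa; rewrite /sqnorm.
have E (Q : 'M[C]_m) : Q *m Q = Q -> Q^t* = Q ->
    \tr (Q *m A *m (Q *m A)^t*) = \tr (Q *m (A *m A^t*)).
  by move=> QQ Qa; rewrite adjointM Qa mulmxA mxtrace_mulC !mulmxA QQ.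
rewrite !E //; first by rewrite -mxtraceD -mulmxDl addrC subrK mul1mx.
  by rewrite mulmxBl mul1mx mulmxBr mulmx1 PP subrr subr0.
by rewrite adjointB adjoint1 Pa.
Qed.

Lemma sqnorm_projection_le m n (P : 'M[C]_m) (A : 'M[C]_(m, n)) :
  P *m P = P -> P^t* = P -> sqnorm (P *m A) <= sqnorm A.
Proof.
by move=> PP Pa; rewrite [leRHS](sqnorm_pythagoras A PP Pa) lerDl sqnorm_ge0.
Qed.

Lemma projection_perp n (P : 'M[C]_n) : P *m P = P -> P^t* = P ->
  (1%:M - P) *m (1%:M - P) = 1%:M - P /\ (1%:M - P)^t* = 1%:M - P.
Proof.
move=> PP Pa; split; last by rewrite adjointB adjoint1 Pa.
by rewrite mulmxBl mul1mx mulmxBr mulmx1 PP subrr subr0.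
Qed.

(** For [k >= 0], says that the operator norm is at most the root of [k], with no supremum
    involved. *)
Definition sqnorm_bounded m n (A : 'M[C]_(m, n)) (k : C) :=
  forall x : 'cV[C]_n, sqnorm (A *m x) <= k * sqnorm x.

(** Expanding [0 <= sqnorm (k *: y - A *m z)] with [z = A^t* *m y] and bounding [sqnorm (A *m z)]
    leaves [k * sqnorm z <= k ^+ 2 * sqnorm y]; then [k] cancels unless it is 0. *)
Lemma sqnorm_bounded_adjoint m n (A : 'M[C]_(m, n)) k :
  0 <= k -> sqnorm_bounded A k -> sqnorm_bounded (A^t*) k.
Proof.
move=> k0 Ak y; set z := A^t* *m y.
have yw : \tr (A *m z *m y^t*) = sqnorm z.
  by rewrite -mulmxA mxtrace_mulC -mulmxA /sqnorm /z adjointM trmxCK.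
have wy : \tr (y *m (A *m z)^t*) = sqnorm z.
  by rewrite adjointM mulmxA mxtrace_mulC !mulmxA.
have := Ak z.
have [-> | kn0] := eqVneq k 0.
  rewrite !mul0r => Az0.
  have /sqnorm_eq0 Az : sqnorm (A *m z) = 0.
    by apply/le_anti; rewrite Az0 sqnorm_ge0.
  by rewrite -yw Az mul0mx mxtrace0.
have kp : 0 < k by rewrite lt_def kn0.
move=> Az; have := sqnorm_ge0 (k *: y - A *m z).
rewrite /sqnorm adjointB adjointZ mulmxBl !mulmxBr (geC0_conj k0).
rewrite -!scalemxAl -!scalemxAr !mxtraceD !linearN /= !mxtraceD !linearN /= !mxtraceZ.
rewrite yw wy -!/(sqnorm _) => H.
rewrite -(ler_pM2l kp) -subr_ge0.
apply: le_trans H _.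
rewrite -subr_ge0.
rewrite (_ : _ - _ = k * sqnorm z - sqnorm (A *m z)) ?subr_ge0 //.
by rewrite opprB; ring.
Qed.

End Adjoint.

(** * Off-diagonal corners of unitary and normal matrices *)

Section Corners.
Variables (C : numClosedFieldType) (n : nat).
Implicit Types (P V T : 'M[C]_n).

Lemma unitmx_of_sqnorm_lower (Y : 'M[C]_n) m : 0 < m ->
  (forall x : 'cV[C]_n, m * sqnorm x <= sqnorm (Y *m x)) -> Y \in unitmx.
Proof.
move=> m0 Ym; rewrite -unitmx_tr -row_free_unit -kermx_eq0.
apply/eqP/eqP/rowV0P => v /sub_kermxP vY.
have Yv : Y *m v^T = 0 by rewrite -[Y]trmxK -trmx_mul vY trmx0.
have := Ym v^T; rewrite Yv sqnorm0 pmulr_rle0 // => v0.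
have /sqnorm_eq0 : sqnorm v^T = 0 by apply/le_anti; rewrite v0 sqnorm_ge0.
by move=> vT0; rewrite -[v]trmxK vT0 trmx0.
Qed.

(** A lower bound [m] on [Y] is an upper bound [m^-1] on its inverse, and upper bounds pass to
    adjoints. *)
Lemma sqnorm_lower_adjoint (Y : 'M[C]_n) m : 0 < m ->
  (forall x : 'cV[C]_n, m * sqnorm x <= sqnorm (Y *m x)) ->
  forall x : 'cV[C]_n, m * sqnorm x <= sqnorm (Y^t* *m x).
Proof.
move=> m0 Ym x; have Yu := unitmx_of_sqnorm_lower m0 Ym.
have YVb : sqnorm_bounded (invmx Y) m^-1.
  by move=> z; rewrite ler_pdivlMl //; have := Ym (invmx Y *m z); rewrite mulKVmx.
have /sqnorm_bounded_adjoint := YVb; rewrite invr_ge0 => /(_ (ltW m0)).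
move=> /(_ (Y^t* *m x)); rewrite mulmxA -adjointM mulmxV // adjoint1 mul1mx.
by rewrite ler_pdivlMl.
Qed.

Lemma sqnorm_bounded_unitary_corner P V k :
  P *m P = P -> P^t* = P -> V \is unitarymx -> 0 <= k ->
  sqnorm_bounded ((1%:M - P) *m V *m P) k ->
  sqnorm_bounded (P *m V *m (1%:M - P)) k.
Proof.
move=> PP Pa Vu k0 Vk; set Q := 1%:M - P in Vk *.
have [QQ Qa] := projection_perp PP Pa.
have PQ : P *m Q = 0 by rewrite mulmxBr mulmx1 PP subrr.
have QP : Q *m P = 0 by rewrite mulmxBl mul1mx PP subrr.
have Vau : V^t* \is unitarymx by rewrite trmxC_unitary.
have Pyth A := @sqnorm_pythagoras C n 1 P A PP Pa.
rewrite -/Q in QQ Qa Pyth; clearbody Q.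
(* The target is the adjoint of a corner of [V^t*], so bounding that corner is enough. *)
have -> : P *m V *m Q = (Q *m V^t* *m P)^t*.
  by rewrite !adjointM trmxCK Pa Qa mulmxA.
apply: sqnorm_bounded_adjoint => // x.
have [k1 | k1] : 1 <= k \/ k < 1.
  by case: (real_leP (real1 C) (ger0_real k0)); [left | right].
  rewrite -!mulmxA; apply: le_trans (sqnorm_projection_le _ QQ Qa) _.
  rewrite sqnorm_unitary //; apply: le_trans (sqnorm_projection_le _ PP Pa) _.
  by rewrite ler_peMl ?sqnorm_ge0.
(* Adding [Q] extends the compression [P *m V *m P] to the whole space, so that the lower bound
   makes it invertible. On the range of [P] the bound is Pythagoras for [V *m P *m z]. *)
have Ylow (z : 'cV[C]_n) :
    (1 - k) * sqnorm z <= sqnorm ((P *m V *m P + Q) *m z).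
  rewrite (Pyth (_ *m z)) !mulmxA !mulmxDr !mulmxDl !mulmxA PP PQ QP QQ !mul0mx.
  rewrite addr0 add0r.
  have := Pyth (V *m P *m z); rewrite -[V *m P *m z]mulmxA sqnorm_unitary //.
  have := Vk (P *m z); rewrite !mulmxA -[_ *m P *m P]mulmxA PP.
  rewrite (Pyth z) -/Q; have := sqnorm_ge0 (Q *m z).
  move: (sqnorm _) (sqnorm _) (sqnorm _) (sqnorm _) => a b c d a0 bc bE; rewrite bE in bc *.
  rewrite -subr_ge0.
  rewrite (_ : _ - _ = (k * (a + c) - c) + k * d); last by ring.
  by rewrite addr_ge0 ?mulr_ge0 // ?subr_ge0.
have k1' : 0 < 1 - k by rewrite subr_gt0.
(* At [P *m x] the compression of [V^t*] keeps at least [1 - k] of the squared norm; Pythagoras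
   leaves at most [k] for the other corner. *)
have := sqnorm_lower_adjoint k1' Ylow (P *m x).
rewrite adjointD !adjointM Pa Qa mulmxDl !mulmxA QP mul0mx addr0.
rewrite -[_ *m P *m P]mulmxA PP.
have := Pyth (V^t* *m P *m x); rewrite -[V^t* *m P *m x]mulmxA sqnorm_unitary //.
have := sqnorm_projection_le x PP Pa.
rewrite !mulmxA.
move: (sqnorm _) (sqnorm _) (sqnorm _) (sqnorm _) => a b c d dc dE H.
apply: le_trans (ler_wpM2l k0 dc).
rewrite -subr_ge0; move: H; rewrite -subr_ge0 dE; congr (0 <= _); ring.
Qed.

(** The row kernel of [1%:M - P] is the row space of [P], so the rank is that of [P] minus that of
    [P *m V :&: P]. Multiplication by [invmx V] carries this intersection into the one for
    [invmx V], and symmetrically. *)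
Lemma mxrank_corner_invmx P V : P *m P = P -> V \in unitmx ->
  \rank (P *m V *m (1%:M - P)) = \rank (P *m invmx V *m (1%:M - P)).
Proof.
move=> PP Vu; set Q := 1%:M - P.
have kQ : (kermx Q :=: P)%MS.
  apply/eqmxP/andP; split.
    have := mulmx_ker Q; rewrite /Q mulmxBr mulmx1 => /subr0_eq ->.
    exact: submxMl.
  by apply/sub_kermxP; rewrite mulmxBr mulmx1 PP subrr.
have rk W : W \in unitmx -> \rank (P *m W *m Q) = (\rank P - \rank (P *m W :&: P))%N.
  move=> Wu; rewrite -(cap_eqmx (eqmx_refl _) kQ).
  have := mxrank_mul_ker (P *m W) Q.
  by rewrite (mxrankMfree P) ?row_free_unit // => <-; rewrite addnK.
rewrite !rk ?unitmx_inv //; congr (_ - _)%N.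
have cap W : W \in unitmx ->
    (\rank (P *m W :&: P)%MS <= \rank (P *m invmx W :&: P)%MS)%N.
  move=> Wu; rewrite -[leqLHS](mxrankMfree _ (_ : row_free (invmx W))).
    rewrite mxrankS // (submx_trans (capmxMr _ _ _)) //.
    by rewrite mulmxK // capmxC.
  by rewrite row_free_unit unitmx_inv.
by apply/eqP; rewrite eqn_leq cap //= -{2}[V]invmxK cap // unitmx_inv.
Qed.

Lemma mxrank_unitary_corner P V : P *m P = P -> P^t* = P -> V \is unitarymx ->
  \rank (P *m V *m (1%:M - P)) = \rank ((1%:M - P) *m V *m P).
Proof.
move=> PP Pa Vu; have [_ Qa] := projection_perp PP Pa.
rewrite mxrank_corner_invmx ?unitarymx_unit // invmx_unitary // -mxrank_adjoint.
by rewrite !adjointM trmxCK Pa Qa mulmxA.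
Qed.

(** Each side is the trace of [P *m T *m T^t*] or of [P *m T^t* *m T], minus the same trace of
    [P *m T *m P *m T^t*]. *)
Lemma sqnorm_normal_corner P T :
  T *m T^t* = T^t* *m T -> P *m P = P -> P^t* = P ->
  sqnorm (P *m T *m (1%:M - P)) = sqnorm ((1%:M - P) *m T *m P).
Proof.
move=> TN PP Pa; have [QQ Qa] := projection_perp PP Pa.
have E (A B : 'M[C]_n) : B *m B = B -> A *m A = A -> A^t* = A -> B^t* = B ->
    sqnorm (A *m T *m B) = \tr (A *m (T *m B *m T^t*)).
  move=> BB AA Aa Ba; rewrite /sqnorm !adjointM Aa Ba !mulmxA mxtrace_mulC !mulmxA.
  by rewrite AA -[_ *m B *m B]mulmxA BB.
rewrite !E // mulmxBr mulmx1 mulmxBl mulmxBr mulmxBl mul1mx !linearB /=.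
by congr (_ - _); rewrite TN mulmxA mxtrace_mulC !mulmxA.
Qed.

Lemma diag_of_corners T : (0 < n)%N ->
  (forall P, P *m P = P -> P^t* = P ->
     P *m T *m (1%:M - P) = 0 -> (1%:M - P) *m T *m P = 0) ->
  exists2 U : 'M[C]_n, U \is unitarymx &
    exists d : 'rV[C]_n, T = U^t* *m diag_mx d *m U.
Proof.
move=> n0 H; have [U Uu /= Ut] := Schur T n0; exists U => //.
rewrite /similar_to /= conjymx // in Ut; move: Ut; set A := U *m T *m U^t* => /is_trig_mxP At.
have TE : T = U^t* *m A *m U.
  by rewrite /A !mulmxA unitarymx_tr // mul1mx -mulmxA unitarymx_tr // mulmx1.
clearbody A.
have A0 (i j : 'I_n) : (j < i)%N -> A i j = 0.
  (* The Schur form [A] is lower triangular. As [E] keeps the coordinates up to [j], the upper right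
     corner vanishes, and the opposite corner contains [A i j]. *)
  move=> ji; pose E := diag_mx (\row_(l < n) (l <= j)%:R : 'rV[C]_n).
  have EE : E *m E = E.
    rewrite mulmx_diag; congr diag_mx; apply/rowP => l; rewrite !mxE.
    by case: leqP; rewrite ?mulr1 ?mulr0.
  have Ea : E^t* = E.
    rewrite adjoint_diag; congr diag_mx; apply/rowP => l; rewrite !mxE.
    by rewrite conjC_nat.
  pose P := U^t* *m E *m U.
  have Qe : 1%:M - P = U^t* *m (1%:M - E) *m U.
    by rewrite mulmxBr mulmxBl mulmx1 unitarymx_tr.
  have UU := unitarymxP Uu.
  have conjM (B D : 'M[C]_n) :
      U^t* *m B *m U *m (U^t* *m D *m U) = U^t* *m (B *m D) *m U.
    by rewrite !mulmxA -[_ *m U *m U^t*]mulmxA UU mulmx1.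
  have conj0 (B : 'M[C]_n) : U^t* *m B *m U = 0 -> B = 0.
    move=> /(congr1 (fun M => U *m M *m U^t*)).
    by rewrite !mulmxA UU mul1mx -mulmxA UU mulmx1 mulmx0 mul0mx.
  have entry (D F : 'rV[C]_n) a b :
      (diag_mx D *m A *m diag_mx F) a b = D 0 a * A a b * F 0 b.
    by rewrite mul_mx_diag mxE mul_diag_mx mxE.
  have E1 : 1%:M - E = diag_mx (\row_(l < n) (j < l)%:R : 'rV[C]_n).
    apply/matrixP => a b; rewrite !mxE ltnNge; case: eqP => [->|_]; last by rewrite subr0.
    by case: leqP; rewrite ?subrr ?subr0.
  have := H P; rewrite Qe TE !conjM EE => /(_ erefl).
  rewrite !adjointM trmxCK Ea mulmxA => /(_ erefl).
  have -> : E *m A *m (1%:M - E) = 0.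
    apply/matrixP => a b; rewrite E1 entry !mxE.
    case: (leqP a j) => aj; last by rewrite !mul0r.
    case: (ltnP j b) => jb; last by rewrite mulr0.
    by rewrite At ?mulr0 ?mul0r // (leq_ltn_trans aj).
  rewrite mulmx0 mul0mx => /(_ erefl) /conj0 /matrixP /(_ i j).
  by rewrite E1 entry !mxE ji leqnn mul1r mulr1.
suff /is_diag_mxP/diag_mxP [d Ad] : forall i j : 'I_n, i != j :> nat -> A i j = 0.
  by exists d; rewrite TE Ad.
move=> i j; case: ltngtP => // ij _; [exact: At | exact: A0].
Qed.
End Corners.

(** * The spectrum on a circle or a line *)

Section Spectrum.
Variables (C : numClosedFieldType) (n : nat).

(** The complement of [proj_ortho X] is orthogonal to its range, whence [P^t* = P *m P^t*], which is
    self-adjoint. *)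
Lemma projection_onto m (X : 'M[C]_(m, n)) :
  exists P : 'M[C]_n, [/\ P *m P = P, P^t* = P & (P :=: X)%MS].
Proof.
pose P := proj_ortho X; have PX : (P :=: X)%MS := proj_orthoE X.
have PP : P *m P = P := proj_ortho_proj X.
have QP : (1%:M - P) *m P^t* = 0.
  apply/orthomx1P; have := proj_ortho_compl_sub X (1%:M : 'M[C]_n).
  rewrite mul1mx -/P => /submx_trans; apply.
  by rewrite submx_ortho PX.
have PaE : P^t* = P *m P^t*.
  by move: QP; rewrite mulmxBl mul1mx => /subr0_eq.
exists P; split=> //.
by rewrite PaE -[in LHS](trmxCK P) -adjointM trmxCK -PaE trmxCK.
Qed.

(* Testing the rank condition on the plane spanned by [x] and [x *m T], with [x]
   the sum of the eigenvectors, makes one corner of rank at most one.  The other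
   one then makes [x], [x *m T], [x *m T^t*] and [x *m T *m T^t*] dependent. *)
Lemma spectrum_dependency (U : 'M[C]_n) (d : 'rV[C]_n)
    (T := U^t* *m diag_mx d *m U) :
  U \is unitarymx ->
  (forall P : 'M[C]_n, P *m P = P -> P^t* = P ->
     (\rank (P *m T *m (1%:M - P)) <= 1)%N ->
     (\rank ((1%:M - P) *m T *m P) <= 1)%N) ->
  exists p q r s : C, ((p != 0) || (q != 0)) /\
    forall j, (p + q * d 0 j) * (d 0 j)^* = r + s * d 0 j.
Proof.
(* The rows of [U] are left eigenvectors of [T], so the rows of [Y *m U] are [x] and [x *m T]. *)
move=> Uu H; pose Y : 'M[C]_(1 + 1, n) := col_mx (const_mx 1) d.
have UU := unitarymxP Uu.
have [P [PP Pa PX]] := projection_onto (Y *m U).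
have [_ Qa] := projection_perp PP Pa.
have PQ : P *m (1%:M - P) = 0 by rewrite mulmxBr mulmx1 PP subrr.
have [Z PZ] : exists Z, P = Z *m (Y *m U) by apply/submxP; rewrite PX.
have [Z' XZ] : exists Z', Y *m U = Z' *m P by apply/submxP; rewrite PX.
have dE : const_mx 1 *m diag_mx d = d :> 'rV[C]_n.
  by apply/rowP => j; rewrite mul_mx_diag !mxE mul1r.
have Ta : T^t* = U^t* *m diag_mx (map_mx Num.conj d) *m U.
  by rewrite !adjointM trmxCK adjoint_diag mulmxA.
have YT : Y *m U *m T = Y *m diag_mx d *m U.
  by rewrite !mulmxA -[Y *m U *m _]mulmxA UU mulmx1.
(* The first row of [Y *m U *m T] is [x *m T], which [1%:M - P] kills; only the second can
   survive. *)
have r1 : (\rank (P *m T *m (1%:M - P)) <= 1)%N.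
  have : Y *m U *m (1%:M - P) = 0 by rewrite XZ -mulmxA PQ mulmx0.
  rewrite !mul_col_mx -[0]vsubmxK => /eq_col_mx [_]; rewrite linear0 => dQ.
  rewrite {1}PZ -(mulmxA Z) YT -(mulmxA Z) (leq_trans (mxrankM_maxr _ _)) //.
  by rewrite !mul_col_mx dE dQ rank_col_0mx rank_leq_row.
have r2 : (\rank (Y *m U *m T^t* *m (1%:M - P)) <= 1)%N.
  rewrite XZ -!mulmxA (leq_trans (mxrankM_maxr _ _)) //.
  rewrite -mxrank_adjoint adjointM [(T^t* *m _)^t*]adjointM trmxCK Pa Qa.
  exact: H.
(* A two-row matrix of rank at most one has a nonzero left kernel vector [w]. Its entries become [p]
   and [q], and those of [v] become [r] and [s]. *)
have : kermx (Y *m U *m T^t* *m (1%:M - P)) != 0.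
  by rewrite kermx_eq0 /row_free neq_ltn (leq_ltn_trans r2).
case/rowV0Pn => w /sub_kermxP w0 wn0.
have [v wv] : exists v, w *m (Y *m U *m T^t*) = v *m (Y *m U).
  apply/submxP; rewrite -PX; move: w0; rewrite !mulmxBr !mulmx1 => /subr0_eq ->.
  by rewrite mulmxA submxMl.
have {}wv : w *m Y *m diag_mx (map_mx Num.conj d) = v *m Y.
  move: wv; rewrite Ta !mulmxA -[w *m Y *m U *m _]mulmxA UU mulmx1.
  move=> /(congr1 (mulmx^~ (U^t*))) /=.
  by rewrite -!mulmxA UU !mulmx1.
have entry (u : 'rV[C]_(1 + 1)) j :
    (u *m Y) 0 j = u 0 (lshift 1 0) + u 0 (rshift 1 0) * d 0 j.
  by rewrite mxE big_split_ord !big_ord1 /= col_mxEu col_mxEd mxE mulr1.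
exists (w 0 (lshift 1 0)), (w 0 (rshift 1 0)), (v 0 (lshift 1 0)), (v 0 (rshift 1 0)).
split=> [|j]; last first.
  by have /rowP/(_ j) := wv; rewrite mul_mx_diag mxE !entry [map_mx _ _ _ _]mxE.
apply: contraNT wn0; rewrite negb_or !negbK => /andP[/eqP w0' /eqP w1'].
apply/eqP/rowP => k; rewrite mxE; case: (splitP k) => i; rewrite (ord1 i) => ki.
  by rewrite -w0'; congr (w _ _); apply: val_inj.
by rewrite -w1'; congr (w _ _); apply: val_inj.
Qed.

(* Adding the equation to its conjugate yields that of a circle when [q != 0];
   when [q = 0] the equation says that [conj] acts affinely on the points. *)
Lemma circle_or_line (d : 'rV[C]_n) (p q r s : C) : (0 < n)%N ->
  (p != 0) || (q != 0) ->
  (forall j, (p + q * d 0 j) * (d 0 j)^* = r + s * d 0 j) ->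
  exists (c m : C) (u : 'rV[C]_n), d = const_mx c + m *: u /\
    ((forall j, u 0 j * (u 0 j)^* = 1) \/ (forall j, (u 0 j)^* = u 0 j)).
Proof.
case: n d => // n' d _ pq Hd.
have [q0 | qn0] := eqVneq q 0.
  rewrite q0 eqxx orbF in pq; pose c := d 0 0.
  have Hc j : (d 0 j - c)^* = s / p * (d 0 j - c).
    apply: (mulfI pq); rewrite rmorphB mulrBr [RHS]mulrA [p * (s / p)]mulrC divfK //.
    have := Hd j; have := Hd 0; rewrite q0 !mul0r !addr0 -/c => -> ->; ring.
  have [j0 j0n | Hall] := pickP (fun j => d 0 j != c); last first.
    exists c, 0, 0; split; last by right=> j; rewrite mxE rmorph0.
    by apply/rowP => j; rewrite !mxE mul0r addr0; have /negbFE/eqP := Hall j.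
  (* Conjugation multiplies every difference [d 0 j - c] by the same [s / p], so their quotients by
     [m] are real. *)
  pose m := d 0 j0 - c; have mn0 : m != 0 by rewrite subr_eq0.
  exists c, m, (\row_j ((d 0 j - c) / m)); split.
    by apply/rowP => j; rewrite !mxE mulrC divfK // addrC subrK.
  right=> j; rewrite mxE rmorphM fmorphV /= !Hc.
  have sp : s / p != 0.
    by have := Hc j0; rewrite -/m; apply: contra_eq_neq => ->; rewrite mul0r conjC_eq0.
  by rewrite invfM mulrACA divff // mul1r.
pose p' := p / q; pose r' := r / q; pose s' := s / q.
have E j : d 0 j * (d 0 j)^* + p' * (d 0 j)^* - s' * d 0 j = r'.
  apply: (mulfI qn0); rewrite /p' /r' /s'.
  rewrite [RHS]mulrC divfK // -[RHS](addrK (s * d 0 j)) -Hd.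
  by field.
clearbody p' r' s'.
(* Centre and squared radius, from completing the square in the mean of [E] and its conjugate. *)
pose c := (s'^* - p') / 2; pose k := (r' + r'^*) / 2 + c * c^*.
have cK : c^* = (s' - p'^*) / 2.
  by rewrite /c rmorphM rmorphB /= conjCK fmorphV rmorph_nat.
have Ek j : (d 0 j - c) * (d 0 j - c)^* = k.
  have := congr1 (fun z => z^*) (E j); rewrite /= rmorphB rmorphD !rmorphM /= !conjCK.
  by rewrite /k => <-; rewrite -(E j) [X in _ * X = _]rmorphB /= cK /c; field.
have k0 : 0 <= k by rewrite -(Ek 0) mul_conjC_ge0.
(* Radius zero: every point is [c], so [m] is 0 and any [u] with unimodular entries will do. *)
have [k00 | kn0] := eqVneq k 0.
  exists c, 0, (const_mx 1); split; last by left=> j; rewrite mxE rmorph1 mulr1.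
  apply/rowP => j; rewrite !mxE mul0r addr0; apply/eqP.
  by rewrite -subr_eq0 -mul_conjC_eq0 Ek k00.
have mn0 : sqrtC k != 0 by rewrite sqrtC_eq0.
exists c, (sqrtC k), (\row_j ((d 0 j - c) / sqrtC k)); split.
  by apply/rowP => j; rewrite !mxE mulrC divfK // addrC subrK.
left=> j; rewrite mxE rmorphM fmorphV /= mulrACA Ek.
by rewrite (geC0_conj (_ : 0 <= sqrtC k)) ?sqrtC_ge0 // -invfM -expr2 sqrtCK divff.
Qed.

End Spectrum.

(** * Singular values through orthogonal columns *)

Section SingularValues.
Variables (C : numClosedFieldType) (n : nat).

(** An unnormalized singular value decomposition: [U] diagonalizes [A^t* *m A], and the squared
    column norms of [B] are the squared singular values. *)
Lemma orthogonal_columns (A : 'M[C]_n) : exists B U : 'M[C]_n,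
  [/\ U \is unitarymx, A = B *m U &
      B^t* *m B = diag_mx (\row_i sqnorm (col i B))].
Proof.
have /orthomx_spectralP : A^t* *m A \is normalmx.
  by apply/normalmxP; rewrite adjointM trmxCK.
have Uu := spectral_unitarymx (A^t* *m A); rewrite invmx_unitary //.
set U := spectralmx _ in Uu *; set s := spectral_diag _ => AE.
have UU := unitarymxP Uu.
exists (A *m U^t*), U; split=> //; first by rewrite -mulmxA unitarymx_tr ?mulmx1.
set B := A *m U^t*.
have BB : B^t* *m B = diag_mx s.
  rewrite adjointM trmxCK mulmxA -[_ *m A^t* *m A]mulmxA AE !mulmxA UU mul1mx.
  by rewrite -mulmxA UU mulmx1.
rewrite BB; congr diag_mx; apply/rowP => i; rewrite mxE.
have /matrixP/(_ i i) := BB; rewrite [RHS]mxE eqxx mulr1n => <-.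
rewrite mxE sqnormE; apply: eq_bigr => l _.
by rewrite big_ord1 !mxE normCK mulrC.
Qed.

Lemma sqnorm_bounded_columns (B U : 'M[C]_n) k : U \is unitarymx ->
  B^t* *m B = diag_mx (\row_i sqnorm (col i B)) ->
  (forall i, sqnorm (col i B) <= k) -> sqnorm_bounded (B *m U) k.
Proof.
move=> Uu BB Bk x; rewrite -mulmxA -[sqnorm x](sqnorm_unitary x Uu).
move: (U *m x) => y; rewrite /sqnorm adjointM mulmxA mxtrace_mulC !mulmxA BB.
rewrite -mulmxA mul_diag_mx /mxtrace mulr_sumr; apply: ler_sum => i _.
rewrite !mxE ler_wpM2r // ?mxE // sumr_ge0 // => l _.
by rewrite !mxE mul_conjC_ge0.
Qed.

Lemma sqnorm_columns (B U : 'M[C]_n) : U \is unitarymx ->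
  sqnorm (B *m U) = \sum_i sqnorm (col i B).
Proof.
move=> Uu; rewrite -sqnorm_adjoint adjointM sqnorm_unitary ?trmxC_unitary //.
rewrite sqnorm_adjoint sqnormE exchange_big; apply: eq_bigr => i _.
by rewrite sqnormE; apply: eq_bigr => l _; rewrite big_ord1 mxE.
Qed.

End SingularValues.

Local Open Scope complex_scope.

(** * The operator norm compared with the Frobenius norm *)

Section OperatorNorm.
Variables (R : realType) (n : nat).
Implicit Types (A B : 'M[R[i]]_n) (k : R).

Lemma euclidean_norm_sqr (x : 'cV[R[i]]_n) : (euclidean_norm x ^+ 2)%:C = sqnorm x.
Proof.
rewrite sqr_sqrtr; last by apply: sumr_ge0 => i _; rewrite exprn_even_ge0.
rewrite rmorph_sum sqnormE; apply: eq_bigr => i _; rewrite big_ord1.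
by rewrite rmorphXn; congr (_ ^+ 2); case: (x i 0) => a b; rewrite normc_def.
Qed.

Lemma euclidean_norm_ge0 (x : 'cV[R[i]]_n) : 0 <= euclidean_norm x.
Proof. exact: sqrtr_ge0. Qed.

Lemma euclidean_norm0 : euclidean_norm (0 : 'cV[R[i]]_n) = 0.
Proof.
apply/eqP; rewrite -sqrf_eq0; apply/eqP/complexI.
by rewrite euclidean_norm_sqr sqnorm0.
Qed.

(** Makes the [sup] in [operator_norm] a genuine supremum; the Frobenius norm is the bound. *)
Lemma operator_norm_set_has_ub A : has_ubound
  [set euclidean_norm (A *m x) | x in
     [set x : 'cV[R[i]]_n | euclidean_norm x <= 1]]%classic.
Proof.
have [k k0 Ak] : exists2 k, 0 <= k & sqnorm_bounded A k%:C.
  have [B [U [Uu -> BB]]] := orthogonal_columns A.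
  exists (complex.Re (sqnorm (B *m U))).
    by rewrite -ler0c RRe_real ?sqnorm_ge0 // ger0_real ?sqnorm_ge0.
  rewrite RRe_real ?ger0_real ?sqnorm_ge0 //.
  apply: sqnorm_bounded_columns => // i; rewrite sqnorm_columns // (bigD1 i) //=.
  by rewrite lerDl sumr_ge0 // => *; apply: sqnorm_ge0.
exists (Num.sqrt k) => _ [x x1 <-].
rewrite -(ler_pXn2r (isT : 0 < 2)%N) ?nnegrE ?sqrtr_ge0 // (sqr_sqrtr k0) -lecR.
rewrite euclidean_norm_sqr; apply: le_trans (Ak x) _.
rewrite -euclidean_norm_sqr -rmorphM lecR ler_piMr // expr_le1 //.
exact: euclidean_norm_ge0.
Qed.

Lemma operator_norm_ge0 A : 0 <= operator_norm A.
Proof.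
apply: (ub_le_sup (operator_norm_set_has_ub A)).
by exists 0; rewrite /= ?mulmx0 euclidean_norm0.
Qed.

Lemma operator_norm_bounded A : sqnorm_bounded A (operator_norm A ^+ 2)%:C.
Proof.
move=> x; set e := euclidean_norm x; have e0 : 0 <= e := euclidean_norm_ge0 x.
have [ez | en0] := eqVneq e 0.
  have /sqnorm_eq0 -> : sqnorm x = 0 by rewrite -euclidean_norm_sqr -/e ez expr0n.
  by rewrite mulmx0 !sqnorm0 mulr0.
have ep : 0 < e by rewrite lt_def en0.
have nx : (euclidean_norm ((e^-1)%:C *: x)) ^+ 2 = 1.
  apply: complexI; rewrite euclidean_norm_sqr sqnormZ -euclidean_norm_sqr -/e.
  rewrite normc_def /= expr0n addr0 sqrtr_sqr ger0_norm ?invr_ge0 //.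
  by rewrite -rmorphXn -rmorphM -exprMn mulVf // expr1n.
have : euclidean_norm (A *m ((e^-1)%:C *: x)) <= operator_norm A.
  apply: (ub_le_sup (operator_norm_set_has_ub A)).
  exists ((e^-1)%:C *: x) => //=.
  by rewrite -(expr_le1 (isT : 0 < 2)%N) ?euclidean_norm_ge0 // nx.
rewrite -(ler_pXn2r (isT : 0 < 2)%N) ?nnegrE ?euclidean_norm_ge0 ?operator_norm_ge0 //.
rewrite -lecR euclidean_norm_sqr -scalemxAr sqnormZ -[sqnorm x]euclidean_norm_sqr -/e.
rewrite normc_def /= expr0n addr0 sqrtr_sqr ger0_norm ?invr_ge0 //.
rewrite fmorphV exprVn ler_pdivrMl ?exprn_gt0 ?ltcR //.
by rewrite -rmorphXn mulrC.
Qed.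

Lemma operator_norm_le A k : 0 <= k -> sqnorm_bounded A k%:C ->
  operator_norm A ^+ 2 <= k.
Proof.
move=> k0 Ak; rewrite -[leRHS]sqr_sqrtr //.
rewrite ler_pXn2r ?nnegrE ?sqrtr_ge0 ?operator_norm_ge0 //.
apply: ge_sup => [|_ [x x1 <-]].
  by exists (euclidean_norm (A *m 0)); exists 0; rewrite //= euclidean_norm0.
rewrite -(ler_pXn2r (isT : 0 < 2)%N) ?nnegrE ?sqrtr_ge0 // (sqr_sqrtr k0) -lecR.
rewrite euclidean_norm_sqr; apply: le_trans (Ak x) _.
rewrite -euclidean_norm_sqr -rmorphM lecR ler_piMr // expr_le1 //.
exact: euclidean_norm_ge0.
Qed.

(** Reduces comparing two norms to transferring bounds, the form in which the corner estimates are
    proved. *)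
Lemma operator_norm_mono A B :
  (forall k : R[i], 0 <= k -> sqnorm_bounded A k -> sqnorm_bounded B k) ->
  operator_norm B <= operator_norm A.
Proof.
move=> AB; rewrite -(ler_pXn2r (isT : 0 < 2)%N) ?nnegrE ?operator_norm_ge0 //.
apply: operator_norm_le; first by rewrite exprn_ge0 ?operator_norm_ge0.
apply: AB; last exact: operator_norm_bounded.
by rewrite ler0c exprn_ge0 ?operator_norm_ge0.
Qed.

Lemma operator_norm_eq0 A : operator_norm A = 0 <-> A = 0.
Proof.
split=> [A0 | ->].
  have Ax (x : 'cV[R[i]]_n) : A *m x = 0.
    apply: sqnorm_eq0; apply/le_anti; rewrite sqnorm_ge0 andbT.
    by have := operator_norm_bounded A x; rewrite A0 expr0n mul0r.
  apply/matrixP => a b; have /matrixP/(_ a 0) := Ax (delta_mx b 0).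
  by rewrite -colE !mxE.
apply/eqP; rewrite -sqrf_eq0 eq_le sqr_ge0 andbT operator_norm_le // => x.
by rewrite mul0mx sqnorm0 mul0r.
Qed.

(** Writing [A = u *m v], the test vector [v^t*] is stretched by exactly the Frobenius norm. *)
Lemma sqnorm_le_operator_norm A : (\rank A <= 1)%N ->
  sqnorm A <= (operator_norm A ^+ 2)%:C.
Proof.
move=> r1; have [u [v AE]] : exists (u : 'cV[R[i]]_n) (v : 'rV[R[i]]_n), A = u *m v.
  have := mulmx_base A; move: (col_base A) (row_base A) r1.
  case: (\rank A) => [|[|//]] B D _ <-; last by exists B, D.
  by exists 0, 0; rewrite mul0mx [B]thinmx0 mul0mx.
have vv : v *m v^t* = (sqnorm v)%:M by rewrite [LHS]mx11_scalar -trace_mx11.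
have AN : sqnorm A = sqnorm v * sqnorm u.
  rewrite AE [LHS]/sqnorm adjointM mulmxA -[u *m v *m _]mulmxA vv.
  by rewrite mul_mx_scalar -scalemxAl mxtraceZ.
have [v0 | vn0] := eqVneq (sqnorm v) 0.
  by rewrite AN v0 mul0r ler0c exprn_ge0 ?operator_norm_ge0.
have vp : 0 < sqnorm v by rewrite lt_def vn0 sqnorm_ge0.
have := operator_norm_bounded A (v^t*).
rewrite {1}AE -mulmxA vv mul_mx_scalar sqnormZ sqnorm_adjoint.
by rewrite ger0_norm ?sqnorm_ge0 // expr2 mulrAC -AN ler_pM2r.
Qed.

(* The squared singular values sum to [sqnorm A], and the largest one is at
   most the squared operator norm. *)
Lemma mxrank_le1_operator_norm A :
  sqnorm A <= (operator_norm A ^+ 2)%:C -> (\rank A <= 1)%N.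
Proof.
have [B [U [Uu -> BB]]] := orthogonal_columns A.
have [n0 | n0] := posnP n; first by rewrite (leq_trans (rank_leq_row _)) // n0.
pose s i := complex.Re (sqnorm (col i B)).
have sE i : (s i)%:C = sqnorm (col i B).
  by rewrite RRe_real // ger0_real // sqnorm_ge0.
have [i0 smax] : exists i0, forall i, s i <= s i0.
  by case: (@arg_maxP _ _ _ (Ordinal n0) xpredT s) => // i0 _ i0P; exists i0 => i; apply: i0P.
have ople : operator_norm (B *m U) ^+ 2 <= s i0.
  apply: operator_norm_le; first by rewrite -ler0c sE sqnorm_ge0.
  by apply: sqnorm_bounded_columns => // i; rewrite -sE sE -!sE lecR.
rewrite sqnorm_columns // => Fop.
have : \sum_i sqnorm (col i B) <= sqnorm (col i0 B).
  by apply: le_trans Fop _; rewrite -sE lecR.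
(* The column norms together do not exceed the largest one, so every other column of [B]
   vanishes. *)
rewrite (bigD1 i0) //= gerDl => H.
have B0 : forall i, i != i0 -> col i B = 0.
  move=> i ii0; apply: sqnorm_eq0.
  have /psumr_eq0P : \sum_(i < n | i != i0) sqnorm (col i B) = 0.
    by apply/le_anti; rewrite H sumr_ge0 // => *; apply: sqnorm_ge0.
  by apply=> // *; apply: sqnorm_ge0.
have -> : B = col i0 B *m delta_mx 0 i0.
  apply/matrixP => a b; rewrite mxE big_ord1 !mxE eqxx /=.
  have [-> | bi0] := eqVneq b i0; first by rewrite mulr1.
  by have /matrixP/(_ a 0) := B0 b bi0; rewrite !mxE mulr0.
by rewrite -mulmxA (leq_trans (mxrankM_maxl _ _)) // rank_leq_col.
Qed.

End OperatorNorm.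

(** * Affine combinations and the two directions of the equivalence *)

Lemma corner_affine (C : comNzRingType) n (P Q S : 'M[C]_n) (c m : C) :
  P *m Q = 0 -> P *m (c%:M + m *: S) *m Q = m *: (P *m S *m Q).
Proof.
move=> PQ; rewrite mulmxDr mulmxDl mul_mx_scalar -scalemxAl PQ scaler0 add0r.
by rewrite -scalemxAr -scalemxAl.
Qed.

(** For nonzero [m], a bound [k] on [m *: A] is the bound [k] divided by the squared modulus of [m]
    on [A]. *)
Lemma sqnorm_bounded_scale_transfer (C : numClosedFieldType) n (A B : 'M[C]_n) (m : C) :
  (forall k, 0 <= k -> sqnorm_bounded A k -> sqnorm_bounded B k) ->
  forall k, 0 <= k -> sqnorm_bounded (m *: A) k -> sqnorm_bounded (m *: B) k.
Proof.
move=> AB k k0 Ak x; rewrite -scalemxAl sqnormZ.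
have [-> | mn0] := eqVneq m 0.
  by rewrite normr0 expr0n mul0r mulr_ge0 ?sqnorm_ge0.
have mp : 0 < `|m| ^+ 2 by rewrite exprn_gt0 ?normr_gt0.
rewrite mulrC -ler_pdivlMr // mulrAC; move: x; apply: AB => [|x].
  by rewrite divr_ge0 // ltW.
by rewrite mulrAC ler_pdivlMr // mulrC -sqnormZ scalemxAl.
Qed.

Section MainImplications.
Variables (R : realType) (n : nat).
Implicit Types T S : 'M[R[i]]_n.

Definition affine_unitary_or_hermitian T :=
  (exists (lambda mu : R[i]) (V : 'M[R[i]]_n),
     V \is unitarymx /\ T = lambda%:M + mu *: V) \/
  (exists (lambda mu : R[i]) (L : 'M[R[i]]_n),
     L ^t* = L /\ T = lambda%:M + mu *: L).

Lemma perp_projection (P : 'M[R[i]]_n) : is_projection P ->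
  [/\ is_projection (perp P), P *m perp P = 0, perp P *m P = 0 &
      perp (perp P) = P].
Proof.
move=> [PP Pa]; have [QQ Qa] := projection_perp PP Pa; split=> //.
- by rewrite /perp mulmxBr mulmx1 PP subrr.
- by rewrite /perp mulmxBl mul1mx PP subrr.
- by rewrite /perp opprB addrC subrK.
Qed.

Lemma affine_common_rank T : affine_unitary_or_hermitian T -> common_rank T.
Proof.
move=> TE P Pp; have [_ PQ QP _] := perp_projection Pp; case: Pp => PP Pa.
have Qa : (perp P)^t* = perp P := (projection_perp PP Pa).2.
have {TE}[c [m [S [-> Srk]]]] : exists c m S, T = c%:M + m *: S /\
    \rank (P *m S *m perp P) = \rank (perp P *m S *m P).
  case: TE => [[c [m [V [Vu ->]]]] | [c [m [L [La ->]]]]]; exists c, m.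
    by exists V; split=> //; apply: mxrank_unitary_corner.
  (* For Hermitian [L] the two corners are adjoint to each other. *)
  by exists L; split=> //; rewrite -mxrank_adjoint !adjointM La Pa Qa mulmxA.
rewrite (corner_affine _ _ _ PQ) (corner_affine _ _ _ QP); have [-> | mn0] := eqVneq m 0.
  by rewrite !scale0r.
by rewrite !mxrank_scale_nz.
Qed.

(** One inequality is enough for (CN), since [P] and [perp P] can be exchanged. *)
Lemma affine_operator_norm_le T P : affine_unitary_or_hermitian T ->
  is_projection P ->
  operator_norm (P *m T *m perp P) <= operator_norm (perp P *m T *m P).
Proof.
move=> TE Pp; have [_ PQ QP _] := perp_projection Pp; case: Pp => PP Pa.
have Qa : (perp P)^t* = perp P := (projection_perp PP Pa).2.
apply: operator_norm_mono.
case: TE => [[c [m [V [Vu ->]]]] | [c [m [L [La ->]]]]].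
  rewrite (corner_affine _ _ _ PQ) (corner_affine _ _ _ QP).
  apply: sqnorm_bounded_scale_transfer => k k0.
  exact: sqnorm_bounded_unitary_corner.
rewrite (corner_affine _ _ _ PQ) (corner_affine _ _ _ QP).
  apply: sqnorm_bounded_scale_transfer => k k0.
by move=> /(sqnorm_bounded_adjoint k0); rewrite !adjointM La Pa Qa mulmxA.
Qed.

Lemma affine_common_norm T : affine_unitary_or_hermitian T -> common_norm T.
Proof.
move=> TE P Pp; apply/le_anti/andP; split.
  exact: affine_operator_norm_le.
have [Qp _ _ QQ] := perp_projection Pp.
by have := affine_operator_norm_le TE Qp; rewrite QQ.
Qed.

(** Collects what (CN) and (CR) have in common. The rank condition is asked only for normal [T],
    where (CN) can supply it; normality is available once the first condition has diagonalized
    [T]. *)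
Lemma affine_of_corners T : (0 < n)%N ->
  (forall P, is_projection P ->
     P *m T *m perp P = 0 -> perp P *m T *m P = 0) ->
  (T *m T^t* = T^t* *m T -> forall P, is_projection P ->
     (\rank (P *m T *m perp P) <= 1)%N -> (\rank (perp P *m T *m P) <= 1)%N) ->
  affine_unitary_or_hermitian T.
Proof.
move=> n0 H0 H1.
have [P PP Pa|U Uu [d TE]] := diag_of_corners n0 (T := T); first exact: H0.
have UU := unitarymxP Uu; have UV := unitarymx_tr Uu.
have conjM (B D : 'M[R[i]]_n) :
    U^t* *m B *m U *m (U^t* *m D *m U) = U^t* *m (B *m D) *m U.
  by rewrite !mulmxA -[_ *m U *m U^t*]mulmxA UU mulmx1.
have conja (B : 'M[R[i]]_n) : (U^t* *m B *m U)^t* = U^t* *m B^t* *m U.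
  by rewrite !adjointM trmxCK mulmxA.
have TN : T *m T^t* = T^t* *m T.
  by rewrite TE conja !conjM adjoint_diag diag_mxC.
have [p [q [r [s [pq Hd]]]]] : exists p q r s : R[i],
    ((p != 0) || (q != 0)) /\
    forall j, (p + q * d 0 j) * Num.conj (d 0 j) = r + s * d 0 j.
  apply: (spectrum_dependency Uu) => P PP Pa; rewrite -TE.
  exact: (H1 TN).
have [c [m [u [dE Hu]]]] := circle_or_line n0 pq Hd.
have {}TE : T = c%:M + m *: (U^t* *m diag_mx u *m U).
  rewrite TE dE raddfD /= diag_const_mx linearZ /= mulmxDr mulmxDl.
  by rewrite mul_mx_scalar -scalemxAl UV -scalemxAr -scalemxAl scalemx1.
case: Hu => Hu; [left | right];
    exists c, m, (U^t* *m diag_mx u *m U); (split; last exact: TE).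
  apply/unitarymxP; rewrite conja conjM adjoint_diag mulmx_diag.
  rewrite (_ : \row__ _ = const_mx 1) ?diag_const_mx ?mulmx1 //.
  by apply/rowP => j; rewrite !mxE Hu.
rewrite conja adjoint_diag; congr (_ *m diag_mx _ *m _).
by apply/rowP => j; rewrite mxE Hu.
Qed.

Lemma common_rank_affine T : (0 < n)%N -> common_rank T ->
  affine_unitary_or_hermitian T.
Proof.
move=> n0 Tr; apply: affine_of_corners => // [P Pp P0 | _ P Pp].
  by apply/eqP; rewrite -mxrank_eq0 -Tr // P0 mxrank0.
by rewrite Tr.
Qed.

(* For normal [T] the two corners have the same Frobenius norm, and a matrix has
   rank at most one exactly when its operator and Frobenius norms agree. *)
Lemma common_norm_affine T : (0 < n)%N -> common_norm T ->
  affine_unitary_or_hermitian T.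
Proof.
move=> n0 Tn; apply: affine_of_corners => // [P Pp P0 | TN P Pp r1].
  by apply/operator_norm_eq0; rewrite -Tn //; apply/operator_norm_eq0.
case: (Pp) => PP Pa; apply: mxrank_le1_operator_norm.
by rewrite -Tn // -sqnorm_normal_corner //; apply: sqnorm_le_operator_norm.
Qed.

End MainImplications.

Unset Implicit Arguments.

Theorem theorem3p15 (R : realType) (n : nat) (hn : (4 <= n)%N)
    (T : 'M[R[i]]_n) :
  (common_norm T <-> common_rank T) /\
  (common_rank T <->
     (exists (lambda mu : R[i]) (V : 'M[R[i]]_n),
        V \is unitarymx /\ T = lambda%:M + mu *: V) \/
     (exists (lambda mu : R[i]) (L : 'M[R[i]]_n),
        L ^t* = L /\ T = lambda%:M + mu *: L)).
Proof.
have n0 : (0 < n)%N by apply: leq_trans hn.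
split; split.
- by move=> /(common_norm_affine n0)/affine_common_rank.
- by move=> /(common_rank_affine n0)/affine_common_norm.
- exact: common_rank_affine.
- exact: affine_common_rank.
Qed.
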